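(* Let $\mathsf a,\mathsf b\ge0$ satisfy $\mathsf a\mathsf b<1$. Fix $d\in\mathbb N$, $0<\theta_1<\dots<\theta_d<\theta_{d+1}=1$ and $0<u_j<v_j$ for $j\in\{1,\dots,d+1\}$ satisfying $v_{d+1}-u_j<\theta_{d+1}-\theta_j$ for $j\in\{1,\dots,d\}$. Then for any fixed $r\in\mathbb N$ and $\varepsilon>0$ there exists $N_0\in\mathbb N$ such that for all $N\ge N_0$ for which the conditioning event below has positive probability, $$\mathbb P_N^{(0,\mathsf a,\mathsf b,0,0)}\Big(\#\{j\in\{0,\dots,N\}:\lambda_1(j)-\lambda_2(j)\le r\}\le\lceil\varepsilon N\rceil\ \Big|\ h_N[\boldsymbol\lambda](\theta_j)\in(u_j,v_j),\ j\in\{1,\dots,d+1\}\Big)\ge e^{-N^{4/5}}.$$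
   Context: **Two-layer configurations.** $\mathcal{TL}_N$ is the set of $\boldsymbol\lambda=(\boldsymbol\lambda_1,\boldsymbol\lambda_2)\in\mathbb Z^{2N+2}$, $\boldsymbol\lambda_i=(\lambda_i(0),\dots,\lambda_i(N))$, such that $\lambda_1(0)=0$; $\lambda_1(j)\ge\lambda_2(j)$ for $0\le j\le N$; and $\lambda_i(j)-\lambda_i(j-1)\in\{0,1\}$ for $i\in\{1,2\}$, $1\le j\le N$. **The two-layer measure for open TASEP.** For $\mathsf a,\mathsf b\ge0$ with $\mathsf a\mathsf b<1$ and $\boldsymbol\lambda\in\mathcal{TL}_N$ (with the convention $0^0=1$), $$\mathrm{wt}_N^{(0,\mathsf a,\mathsf b,0,0)}(\boldsymbol\lambda)=\mathsf a^{\lambda_1(0)-\lambda_2(0)}\,\mathsf b^{\lambda_1(N)-\lambda_2(N)},\qquad \mathbb P_N^{(0,\mathsf a,\mathsf b,0,0)}(\boldsymbol\lambda)=\frac{\mathrm{wt}_N^{(0,\mathsf a,\mathsf b,0,0)}(\boldsymbol\lambda)}{Z_N^{(0,\mathsf a,\mathsf b,0,0)}},$$ where $Z_N^{(0,\mathsf a,\mathsf b,0,0)}=\sum_{\boldsymbol\lambda\in\mathcal{TL}_N}\mathrm{wt}_N^{(0,\mathsf a,\mathsf b,0,0)}(\boldsymbol\lambda)$, which is finite; this is a probability measure on $\mathcal{TL}_N$. **Height profile.** For $\boldsymbol\lambda\in\mathcal{TL}_N$, $h_N[\boldsymbol\lambda]:[0,1]\to\mathbb R$ is the function with $h_N[\boldsymbol\lambda](k/N)=\lambda_1(k)/N$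 for $k=0,\dots,N$, extended by linear interpolation. $\mathbb N=\{1,2,\dots\}$. *)

(* Defs.v *)
From mathcomp Require Import all_boot all_order all_algebra.
From mathcomp Require Import all_classical all_reals all_analysis.

Set Implicit Arguments.
Unset Strict Implicit.
Unset Printing Implicit Defensive.

Import Order.TTheory GRing.Theory Num.Theory.
Local Open Scope classical_set_scope.
Local Open Scope ring_scope.

Section two_layer.
Variable N : nat.

(* Z^(2N+2); l.1 and l.2 are the top and the bottom layer. *)
Definition config : Type :=
  ({ffun 'I_N.+1 -> int} * {ffun 'I_N.+1 -> int})%type.

Definition unit_steps (p : {ffun 'I_N.+1 -> int}) : Prop :=
  forall j k : 'I_N.+1, k = j.+1 :> nat -> p k - p j = 0 \/ p k - p j = 1.

Definition TL : set config :=
  [set l : config | [/\ l.1 ord0 = 0,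
               (forall j : 'I_N.+1, l.2 j <= l.1 j),
               unit_steps l.1 &
               unit_steps l.2]].

Variable R : realType.

Section measure.
Variables a b : R.

(* The exponents are integers, nonnegative on TL; x ^ 0 = 1 also for x = 0. *)
Definition wt (l : config) : R :=
  a ^ (l.1 ord0 - l.2 ord0) * b ^ (l.1 ord_max - l.2 ord_max).

Definition Zpart : \bar R := \esum_(l in TL) (wt l)%:E.

Definition mass (l : config) : \bar R := ((wt l)%:E / Zpart)%E.

Definition Prob (A : set config) : \bar R := \esum_(l in TL `&` A) mass l.

Definition condProb (A B : set config) : \bar R :=
  (Prob (A `&` B) / Prob B)%E.

End measure.

(* Meant for 0 <= x <= 1 and N > 0.  At x = 1 we have k = N: the out-of-range
   value at k.+1 = N.+1 is then multiplied by 0. *)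
Definition height (l : config) (x : R) : R :=
  let k := Num.truncn (N%:R * x) in
  let y (i : nat) : R := (l.1 (inord i))%:~R / N%:R in
  y k + (N%:R * x - k%:R) * (y k.+1 - y k).

Lemma height_node (l : config) (k : 'I_N.+1) : (0 < N)%N ->
  height l (k%:R / N%:R) = (l.1 k)%:~R / N%:R.
Proof.
move=> N0; rewrite /height (mulrC N%:R) divfK ?pnatr_eq0 -?lt0n//.
by rewrite natrK subrr mul0r addr0 inord_val.
Qed.

Lemma height_affine (l : config) (j k : 'I_N.+1) (t : R) :
  k = j.+1 :> nat -> 0 <= t <= 1 ->
  height l ((j%:R + t) / N%:R) =
  (1 - t) * ((l.1 j)%:~R / N%:R) + t * ((l.1 k)%:~R / N%:R).
Proof.
move=> kj /andP[t0 t1].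
have N0 : (0 < N)%N by have := ltn_ord k; rewrite kj ltnS; apply: leq_trans.
have [t1'|] := ltP t 1; last first.
  move=> t1'; have -> : t = 1 by apply/eqP; rewrite eq_le t1 t1'.
  by rewrite subrr mul0r add0r mul1r natr1 -kj height_node.
rewrite /height (mulrC N%:R) divfK ?pnatr_eq0 -?lt0n//.
have -> : Num.truncn (j%:R + t) = j.
  by apply/truncn_def; rewrite lerDl t0 -natr1 ltrD2l.
rewrite -kj !inord_val addrAC subrr add0r mulrBl mul1r mulrBr.
by rewrite -addrA [X in _ = _ + X]addrC.
Qed.

Definition few_contacts (r : nat) (eps : R) : set config :=
  [set l : config | #|[pred j : 'I_N.+1 | l.1 j - l.2 j <= r%:Z]|%:Z
             <= Num.ceil (eps * N%:R)].

Definition pinned (d : nat) (theta u v : 'I_d.+1 -> R) : set config :=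
  [set l : config | forall j, u j < height l (theta j) < v j].

End two_layer.

(* Main.v *)
Require Import Defs.
From mathcomp Require Import all_boot all_order all_algebra.
From mathcomp Require Import all_classical all_reals all_analysis.
From mathcomp Require Import zify ring lra.

Set Implicit Arguments.
Unset Strict Implicit.
Unset Printing Implicit Defensive.

Import Order.TTheory GRing.Theory Num.Theory.
Local Open Scope classical_set_scope.
Local Open Scope ring_scope.

(** Fix K = r + 1.  A pinned configuration is turned into a pinned one with at
    most 2K contacts (sites where the layers are at distance at most r) by a
    weight-preserving map that is injective up to
    polynomially many choices, so the conditional probability is at least an
    inverse power of N, far above exp (- N^(4/5)).

    The map separates the layers ([separate]).  The lower layer is pushed down
    by K wherever its endpoint values permit ([lower]): if it has room, its
    first K up-steps are deleted and its last K flat steps become up-steps.  What can still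
    touch the upper layer is then the initial stretch where the lower layer sits
    at its starting height, and the final stretch where it climbs to its end
    with slope 1.  The upper layer is made to leave these stretches
    immediately ([raise]): its first K steps become up-steps and its last K
    steps become flat.  Contacts survive only within distance K of the two
    ends ([contact_boundary]), and 2K is at most eps N for large N.  All four
    endpoint heights are kept, hence so is the weight.

    The upper layer also keeps its height wherever it has already made K
    up-steps and still has K flat steps to make ([raiseE]).  This is what the
    hypotheses on u and v provide at the pinned points ([pinned_room]): u_j > 0
    forces a number of up-steps proportional to N before theta_j, and
    v_(d+1) - u_j < 1 - theta_j forces a number of flat steps proportional to N
    after it.  Hence the new configuration is pinned as well.

    A path is recovered from its image once the positions of its first K
    up-steps and last K flat steps are known ([lower_code_inj],
    [raise_code_inj]); for two layers this leaves at most (N+2)^(4K) preimages.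
    Summing the mass over the fibres ([esum_le_card_code]) bounds the
    probability of the pinning by (N+2)^(4K) times that of the intersection. *)

(** * Raising and lowering paths with steps 0 or 1 *)

Section paths.
Variable N : nat.
Implicit Types (p q : {ffun 'I_N.+1 -> int}) (j k : 'I_N.+1) (K : nat).

(** Up-steps made before j. *)
Definition ups p j : int := p j - p ord0.

(** Flat steps still to be made after j. *)
Definition flats p j : int := (N%:Z - j%:Z) - (p ord_max - p j).

Lemma unit_steps_le p j k : unit_steps p -> (j <= k)%N ->
  0 <= p k - p j <= k%:Z - j%:Z.
Proof.
move=> sp; case: k => k; elim: k => [|k IH] ltk /= jk.
  have -> : Ordinal ltk = j by apply/val_inj => /=; lia.
  lia.
have [eqj|jk'] := eqVneq (j : nat) k.+1.
  have -> : Ordinal ltk = j by apply/val_inj => /=; lia.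
  lia.
have ltk' : (k < N.+1)%N by lia.
have := IH ltk' ltac:(move=> /=; lia) => /=.
by have := sp (Ordinal ltk') (Ordinal ltk) erefl; lia.
Qed.

Lemma ups_mono p j k : unit_steps p -> (j <= k)%N -> ups p j <= ups p k.
Proof. by move=> sp /(unit_steps_le sp); rewrite /ups; lia. Qed.

Lemma flats_anti p j k : unit_steps p -> (j <= k)%N -> flats p k <= flats p j.
Proof. by move=> sp /(unit_steps_le sp); rewrite /flats; lia. Qed.

(** The smallest path above p whose first K steps go up and whose last K steps
    are flat, when p makes at least K steps of each kind. *)
Definition raise K p : {ffun 'I_N.+1 -> int} :=
  [ffun j : 'I_N.+1 => Num.max (p j) (Num.max (p ord0 + Num.min j%:Z K%:Z)
            (p ord_max - Num.max 0 (N%:Z - K%:Z - j%:Z)))].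

(** The translate of p by - K, kept above the lowest path with steps 0 or 1
    that has the endpoints of p. *)
Definition lower K p : {ffun 'I_N.+1 -> int} :=
  [ffun j : 'I_N.+1 => Num.max (p j - K%:Z) (Num.max (p ord0)
            (p ord_max - (N%:Z - j%:Z)))].

Lemma raise_steps K p : unit_steps p -> unit_steps (raise K p).
Proof. by move=> sp j k kj; rewrite !ffunE; have := sp j k kj; lia. Qed.

Lemma lower_steps K p : unit_steps p -> unit_steps (lower K p).
Proof. by move=> sp j k kj; rewrite !ffunE; have := sp j k kj; lia. Qed.

Lemma leq_ord_max j : (j <= (ord_max : 'I_N.+1))%N.
Proof. by case: j => j /=. Qed.

(** Once p has made K up-steps it is above the initial rise, and as long as K
    flat steps remain it is above the path reaching its plateau at N - K. *)
Lemma raiseE K p j : K%:Z <= ups p j -> K%:Z <= flats p j -> raise K p j = p j.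
Proof. by rewrite /ups /flats ffunE; have := leq_ord_max j => /=; lia. Qed.

Lemma raise0 K p : K%:Z <= flats p ord0 -> raise K p ord0 = p ord0.
Proof. by rewrite /flats ffunE /=; lia. Qed.

Lemma raise_max K p : K%:Z <= ups p ord_max -> raise K p ord_max = p ord_max.
Proof. by rewrite /ups ffunE /=; lia. Qed.

Lemma lowerE K p j : unit_steps p ->
  lower K p j = p j - Num.min K%:Z (Num.min (ups p j) (flats p j)).
Proof. by rewrite /ups /flats ffunE; lia. Qed.

Lemma lower0 K p : unit_steps p -> lower K p ord0 = p ord0.
Proof.
move=> sp; have := @unit_steps_le p ord0 ord_max sp (leq0n N).
by rewrite ffunE /=; lia.
Qed.

Lemma lower_max K p : unit_steps p -> lower K p ord_max = p ord_max.
Proof.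
move=> sp; have := @unit_steps_le p ord0 ord_max sp (leq0n N).
by rewrite ffunE /=; lia.
Qed.

Lemma lower_le K p j : unit_steps p -> lower K p j <= p j.
Proof.
move=> sp; have := @unit_steps_le p ord0 j sp (leq0n j).
have := unit_steps_le sp (leq_ord_max j).
by rewrite ffunE /=; lia.
Qed.

Lemma raise_ge K p j : p j <= raise K p j.
Proof. by rewrite ffunE; lia. Qed.

(** After raising p and lowering q, the only places at distance less than K are
    the K sites at either end: elsewhere the raised path is at least K above the
    constant path through the start of q, at least K above the slope-1 path
    through its end, and at least as high as q, so it is K above [lower K q],
    the maximum of q - K and these two paths. *)
Lemma contact_boundary K p q j :
  q ord0 <= p ord0 -> q ord_max <= p ord_max -> q j <= p j ->
  raise K p j - lower K q j < K%:Z -> (j < K)%N \/ (N - K < j)%N.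
Proof. by rewrite !ffunE; have := leq_ord_max j => /=; lia. Qed.

Definition code_type K : finType :=
  ({ffun 'I_K -> 'I_N.+2} * {ffun 'I_K -> 'I_N.+2})%type.

(** For i < K, the number of sites with at most i up-steps before them locates
    the up-step of rank i, and the number of sites with more than i flat steps
    after them locates the flat step of rank i from the end. *)
Definition path_code K p : code_type K :=
  ([ffun i : 'I_K => inord #|[pred j | ups p j <= i%:Z]|],
   [ffun i : 'I_K => inord #|[pred j | i%:Z < flats p j]|]).

Definition down_closed (P : pred 'I_N.+1) :=
  forall j k, (j <= k)%N -> P k -> P j.

(** Initial segments form a chain, so the size of one determines it. *)
Lemma down_closed_card (P Q : pred 'I_N.+1) : down_closed P -> down_closed Q ->
  #|P| = #|Q| -> P =1 Q.
Proof.
move=> dP dQ PQ; have [sPQ|] := boolP (P \subset Q).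
  exact: subset_cardP PQ sPQ.
move=> /subsetPn [k Pk nQk] x; apply/esym; move: x.
apply: (subset_cardP (esym PQ)).
apply/fintype.subsetP => j Qj; apply: dP Pk; rewrite leqNgt; apply/negP => kj.
by move: nQk; rewrite -topredE /= (dQ _ _ (ltnW kj) Qj).
Qed.

Lemma inord_card_inj (P Q : pred 'I_N.+1) :
  (inord #|P| : 'I_N.+2) = inord #|Q| -> #|P| = #|Q|.
Proof.
by move/(congr1 val); rewrite /= !inordK // ltnS;
   rewrite -[X in (_ <= X)%N]card_ord max_card.
Qed.

(** The code determines the up-step count and the count of remaining flat steps,
    each truncated at K, since these counts are monotone along the path. *)
Lemma path_code_inj K p q : unit_steps p -> unit_steps q ->
  path_code K p = path_code K q ->
  forall j, Num.min K%:Z (ups p j) = Num.min K%:Z (ups q j) /\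
            Num.min K%:Z (flats p j) = Num.min K%:Z (flats q j).
Proof.
move=> sp sq [/ffunP cU /ffunP cF] j.
have U i : (i < K)%N -> (ups p j <= i%:Z) = (ups q j <= i%:Z).
  move=> iK; have := cU (Ordinal iK); rewrite !ffunE => /inord_card_inj.
  move=> /down_closed_card-/(_ _ _ j); apply => k l kl /=;
  [have := ups_mono sp kl|have := ups_mono sq kl]; lia.
have F i : (i < K)%N -> (i%:Z < flats p j) = (i%:Z < flats q j).
  move=> iK; have := cF (Ordinal iK); rewrite !ffunE => /inord_card_inj.
  move=> /down_closed_card-/(_ _ _ j); apply => k l kl /=;
  [have := flats_anti sp kl|have := flats_anti sq kl]; lia.
have up0 := @ups_mono p ord0 j sp (leq0n j).
have uq0 := @ups_mono q ord0 j sq (leq0n j).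
have fp0 := flats_anti sp (leq_ord_max j).
have fq0 := flats_anti sq (leq_ord_max j).
have [F1 F2] : (flats p ord_max = 0 /\ flats q ord_max = 0) by rewrite /flats /=; lia.
have [U1 U2] : (ups p ord0 = 0 /\ ups q ord0 = 0) by rewrite /ups /=; lia.
(* Testing both sides at the smaller count, when it is below K, forces equality. *)
have Ua := U `|ups p j|%N. have Ub := U `|ups q j|%N.
have Fa := F `|flats p j|%N. have Fb := F `|flats q j|%N.
split; lia.
Qed.

(** By [lowerE] the displacement depends only on the truncated counts. *)
Lemma lower_code_inj K p q : unit_steps p -> unit_steps q ->
  path_code K p = path_code K q -> lower K p = lower K q -> p = q.
Proof.
move=> sp sq c /ffunP e; suff pq (j : 'I_N.+1) : p j = q j by apply/ffunP.
by have := e j; rewrite !lowerE//; have := path_code_inj sp sq c j; lia.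
Qed.

(** Where raising moves a site, one of the two counts is below K there; it is
    then known from the code and gives the height relative to an endpoint. *)
Lemma raise_code_inj K p q : unit_steps p -> unit_steps q ->
  p ord0 = q ord0 -> K%:Z <= ups p ord_max -> K%:Z <= ups q ord_max ->
  path_code K p = path_code K q -> raise K p = raise K q -> p = q.
Proof.
move=> sp sq e0 Up Uq c /ffunP e.
have eN := e ord_max; rewrite !raise_max// in eN.
suff pq (j : 'I_N.+1) : p j = q j by apply/ffunP.
have := e j; have := path_code_inj sp sq c j.
by rewrite !ffunE /ups /flats; have := leq_ord_max j => /=; lia.
Qed.

End paths.

Lemma card_code_type N K : #|code_type N K| = (N.+2 ^ (2 * K))%N.
Proof. by rewrite card_prod card_ffun !card_ord -expnD addnn mul2n. Qed.

(** * Sums over fibres and conditional probabilities *)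

Lemma le_esum_subset (R : realType) (T : choiceType) (A B : set T)
    (f : T -> \bar R) : A `<=` B -> (forall x, B x -> 0 <= f x)%E ->
  (\esum_(x in A) f x <= \esum_(x in B) f x)%E.
Proof.
move=> AB f0; rewrite [leRHS](esumID A)// setIidr//.
by apply: leeDl; apply: esum_ge0 => x [/f0].
Qed.

(** On each level set of c the map phi is injective, so f sums there to at most
    the sum of f over B. *)
Lemma esum_le_card_code (R : realType) (T : choiceType) (C : finType)
    (A B : set T) (f : T -> \bar R) (phi : T -> T) (c : T -> C) :
  (forall x, 0 <= f x)%E -> (forall x, A x -> B (phi x)) ->
  (forall x, A x -> f (phi x) = f x) ->
  (forall x y, A x -> A y -> c x = c y -> phi x = phi y -> x = y) ->
  (\esum_(x in A) f x <= #|C|%:R%:E * \esum_(x in B) f x)%E.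
Proof.
move=> f0 AB fphi inj.
have -> : \esum_(x in A) f x =
    \esum_(x in A) (\sum_(i : C) if x \in [set x | c x = i] then f x else 0)%E.
  apply: eq_esum => x Ax; rewrite (bigD1 (c x))//= mem_set//.
  rewrite big1 ?adde0// => i ne; rewrite memNset//=.
  by move=> ci; rewrite ci eqxx in ne.
rewrite esum_sum; last by move=> x i _ _; case: ifP.
rewrite mule_natl /enatmul Monoid.iteropE -big_const.
apply: lee_sum => i _; rewrite -esum_mkcondr.
rewrite -(@eq_esum _ _ _ (f \o phi)); last by move=> x [Ax _] /=; apply: fphi.
rewrite -(@esum_image _ _ _ (A `&` _) phi f).
  by apply: le_esum_subset => // _ [x [Ax _] <-]; apply: AB.
move=> x y /set_mem[Ax <-] /set_mem[Ay cy] e; exact: inj.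
Qed.

Section measure.
Variables (R : realType) (N : nat) (a b : R).
Hypotheses (ha : 0 <= a) (hb : 0 <= b).
Implicit Types l : config N.

Lemma wt_ge0 l : 0 <= wt a b l.
Proof. by rewrite mulr_ge0// exprz_ge0. Qed.

Lemma Zpart_ge0 : (0 <= Zpart N a b)%E.
Proof. by apply: esum_ge0 => l _; rewrite lee_fin wt_ge0. Qed.

Lemma mass_ge0 l : (0 <= mass a b l)%E.
Proof. by rewrite mule_ge0 ?inve_ge0 ?Zpart_ge0// lee_fin wt_ge0. Qed.

(** The sum Z may be taken as an arbitrary extended number: if Z is 0 or
    infinite, all masses vanish, by the conventions 0 * +oo = 0 and
    1 / +oo = 0, which contradicts the hypothesis; otherwise the masses sum
    to at most 1. *)
Lemma Prob_fin_num B : (0 < Prob a b B)%E -> Prob (N := N) a b B \is a fin_num.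
Proof.
move=> P0; rewrite ge0_fin_numE ?(ltW P0)//.
have P0' : ~ (forall l, TL l -> mass a b l = 0%E).
  by move=> m0; move: P0; rewrite /Prob esum1 ?ltxx// => l [/m0].
have Z0 := Zpart_ge0.
suff /(_ _ erefl) : forall z : \bar R, z = Zpart N a b ->
  (Prob a b B < +oo)%E by [].
case=> [z|zE|]; last by move=> zE; rewrite -zE in Z0.
  move=> zE; have z0 : 0 < z.
    rewrite lt_neqAle -lee_fin zE Z0 andbT; apply/eqP => z0; apply: P0' => l Tl.
    rewrite /mass; suff -> : wt a b l = 0 by rewrite mul0e.
    apply/eqP; rewrite eq_le wt_ge0 andbT -lee_fin [in leRHS]z0 zE.
    rewrite -[leLHS](@esum_set1 R _ l (fun l => (wt a b l)%:E)) ?lee_fin ?wt_ge0//.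
    by apply: le_esum_subset => [_ -> //|x _]; rewrite lee_fin wt_ge0.
  apply: (@le_lt_trans _ _ 1%E); last exact: ltry.
  apply: (@le_trans _ _ (\esum_(l in @TL N) mass a b l)).
    by apply: le_esum_subset => [l []//|l _]; apply: mass_ge0.
  apply: ge_ereal_sup => _ [X [finX XI] <-].
  rewrite (_ : (\sum_(i \in X) _ = \sum_(l \in X) (z^-1)%:E * (wt a b l)%:E)%E); last first.
    by apply: eq_fsbigr => l _; rewrite /mass -zE muleC inver gt_eqF.
  rewrite -ge0_mule_fsumr; last by move=> l; rewrite lee_fin wt_ge0.
  rewrite lee_pdivrMl// mule1 zE.
  by apply: ereal_sup_ubound; exists X.
by exfalso; apply: P0' => l _; rewrite /mass -zE invey mule0.
Qed.

Lemma condProb_ge (A B : set (config N)) (M : R) :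
  0 < M -> (0 < Prob a b B)%E ->
  (Prob a b B <= M%:E * Prob a b (A `&` B))%E ->
  (M^-1%:E <= condProb a b A B)%E.
Proof.
move=> M0 P0 le; have := Prob_fin_num P0; rewrite /condProb.
case: (Prob a b B) P0 le => // p p0 le _; rewrite lte_fin in p0.
by rewrite inver gt_eqF// lee_pdivlMr// lee_pdivrMl.
Qed.

End measure.

(** * Thresholds for N *)

(** A single term of the exponential series at N^(4/5) suffices: the one of
    degree 10m + 1 exceeds a multiple of N^(8m), hence (N+2)^m for large N. *)
Lemma poly_le_exp (R : realType) (m : nat) :
  exists N0, forall N, (N0 <= N)%N ->
    (N.+2 ^ m)%:R <= expR (N%:R `^ (4 / 5)) :> R.
Proof.
pose M := ((10 * m).+1)`!.
exists (3 ^ m * M)%N => N hN.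
have M0 : (0 < M)%N by rewrite fact_gt0.
have N1 : (0 < N)%N by apply: leq_trans hN; rewrite muln_gt0 expn_gt0.
have Nr : 1 <= N%:R :> R by rewrite ler1n.
case: (posnP m) => [->|m0].
  by rewrite expn0 (le_trans _ (expR_ge1Dx _))// lerDl powR_ge0.
set x := N%:R `^ (4 / 5).
have x1 : 1 <= x.
  by rewrite -[leLHS](powRr0 (N%:R : R)) ler_powR//; lra.
have x0 : 0 <= x by apply: le_trans x1.
apply: le_trans (le_trans _ (expR_ge1Dxn (10 * m) x0)) => //.
rewrite -/M; apply: (@le_trans _ _ (x ^+ (10 * m) / M%:R)); last first.
  rewrite -[leLHS]add0r lerD// ler_wpM2r ?invr_ge0// exprS ler_peMl ?exprn_ge0//.
have -> : x ^+ (10 * m) = N%:R ^+ (8 * m).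
  rewrite -powR_mulrn// /x -powRrM -[RHS]powR_mulrn//.
  by congr (_ `^ _); rewrite !natrM; field.
rewrite ler_pdivlMr ?ltr0n// -natrX -natrM ler_nat.
apply: (@leq_trans ((3 * N) ^ m * M)).
  by rewrite leq_mul2r leq_exp2r//; apply/orP; right; lia.
rewrite expnMn mulnAC; apply: (@leq_trans (N * N ^ m)).
  by rewrite leq_mul2r hN orbT.
by rewrite -expnS leq_pexp2l//; lia.
Qed.

Lemma archimedean_family (R : realType) (I : finType) (c : I -> R) (M : R) :
  (forall i, 0 < c i) ->
  exists N0, forall N, (N0 <= N)%N -> forall i, M <= c i * N%:R.
Proof.
move=> c0; exists (\max_i (Num.truncn (M / c i)).+1) => N hN i.
have : ((Num.truncn (M / c i)).+1 <= N)%N.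
  by apply: leq_trans hN; exact: (leq_bigmax (F := fun i => (Num.truncn (M / c i)).+1) i).
case: {hN}N => // N; rewrite ltnS truncn_le_nat ltr_pdivrMr// => /ltW.
by rewrite mulrC.
Qed.

(** * The height profile near a pinned point *)

Section height.
Variables (R : realType) (N : nat).
Implicit Types (l : config N) (x : R).

Lemma heightM l x (k := Num.truncn (N%:R * x)) : (0 < N)%N ->
  N%:R * height l x = (l.1 (inord k))%:~R +
    (N%:R * x - k%:R) * ((l.1 (inord k.+1))%:~R - (l.1 (inord k))%:~R).
Proof.
move=> N0; have Nr : N%:R != 0 :> R by rewrite pnatr_eq0 -lt0n.
by rewrite /height -/k; field.
Qed.

Lemma height1 l : (0 < N)%N -> N%:R * height l (1 : R) = (l.1 ord_max)%:~R.
Proof.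
move=> N0; have Nr : N%:R != 0 :> R by rewrite pnatr_eq0 -lt0n.
by rewrite -[X in height l X](divff Nr) (height_node R l ord_max)// mulrC divfK.
Qed.

Lemma cell_bound x : (0 < N)%N -> x < 1 -> (Num.truncn (N%:R * x) < N)%N.
Proof.
move=> N0 x1; case: N N0 => // n _.
rewrite ltnS truncn_le_nat.
by rewrite gtr_pMr.
Qed.

(** Since the height at x lies between the heights at the ends of its cell and
    the path starts at 0, more than u N - 1 up-steps precede the cell.  Of the
    at least (1 - x) N - 1 steps that follow it, fewer than (v - u) N go up. *)
Lemma pinned_room l x (u v : R) (K : nat) (k := Num.truncn (N%:R * x)) :
  (0 < N)%N -> 0 <= x < 1 -> TL l ->
  u < height l x -> height l (1 : R) < v ->
  K.+1%:R <= u * N%:R -> K.+1%:R <= (1 - x - (v - u)) * N%:R ->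
  K%:Z <= ups l.1 (inord k) /\ K%:Z <= flats l.1 (inord k.+1).
Proof.
move=> N0 /andP[x0 x1] [l0 _ s1 _] ux v1 Ku Kv.
have kN := cell_bound N0 x1; rewrite -/k in kN.
have Nr : 0 < N%:R :> R by rewrite ltr0n.
have /truncn_itv : 0 <= N%:R * x by rewrite mulr_ge0.
rewrite -/k -natr1 => /andP[kx xk].
have hM := heightM l x N0; rewrite -/k in hM.
have h1 := height1 l N0.
have ux' : u * N%:R < N%:R * height l x by rewrite mulrC ltr_pM2l.
have v1' : N%:R * height l 1 < v * N%:R by rewrite (mulrC v) ltr_pM2l.
have kv : inord k = k :> nat := inordK (leqW kN).
have k1v : inord k.+1 = k.+1 :> nat := inordK (kN : (k.+1 < N.+1)%N).
have := s1 (inord k) (inord k.+1) ltac:(by rewrite kv k1v).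
rewrite /ups /flats l0 subr0 k1v /=.
move: hM h1; set p := l.1 _; set p1 := l.1 (inord k.+1).
set q := l.1 ord_max => hM h1 st.
have [pp1 p1p] : (p1%:~R - p%:~R <= 1 :> R) /\ (0 <= p1%:~R - p%:~R :> R).
  by rewrite -intrB; case: st => ->; rewrite /= ?lexx ?ler01.
rewrite -2!(ler_int R) !(intrB, intrD) -!pmulrn -[k.+1%:R]natr1.
rewrite -[K.+1%:R]natr1 in Ku Kv.
split; first by nra.
have : N%:R * height l x <= p1%:~R by rewrite hM; nra.
nra.
Qed.

End height.

(** * Separating the two layers *)

Definition separate N K (l : config N) : config N := (raise K l.1, lower K l.2).

Section separate.
Variables (N K : nat).
Implicit Types l : config N.

Lemma separate_TL l : TL l -> K%:Z <= flats l.1 ord0 -> TL (separate K l).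
Proof.
move=> [l0 l21 s1 s2] F0; split => /=; last exact: lower_steps.
- by rewrite raise0.
- move=> j; apply: le_trans (raise_ge _ _ _).
  by apply: le_trans (l21 j); exact: lower_le.
- exact: raise_steps.
Qed.

Lemma mass_separate (R : realType) (a b : R) l : TL l ->
  K%:Z <= ups l.1 ord_max -> K%:Z <= flats l.1 ord0 ->
  mass a b (separate K l) = mass a b l.
Proof.
move=> [_ _ s1 s2] UN F0.
by rewrite /mass /wt /= raise0// raise_max// lower0// lower_max.
Qed.

Lemma separate_few l : TL l ->
  (#|[pred j : 'I_N.+1 |
       ((separate K l).1 j - (separate K l).2 j < K%:Z)%R]| <= 2 * K)%N.
Proof.
move=> [_ l21 _ _].
pose E : {set 'I_N.+1} := ((fun i : 'I_K => inord i) @: 'I_K :|: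
                           (fun i : 'I_K => inord (N - i)) @: 'I_K)%SET.
apply: (@leq_trans #|E|); last first.
  rewrite (leq_trans (leq_card_setU _ _))// mul2n -addnn leq_add//;
    by rewrite (leq_trans (leq_imset_card _ _))// card_ord.
apply/subset_leq_card/fintype.subsetP => j; rewrite inE /=.
move=> /(contact_boundary (l21 ord0) (l21 ord_max) (l21 j)) jK; rewrite inE.
case: jK => jK; apply/orP; [left|right].
  by apply/imsetP; exists (Ordinal jK) => //; rewrite /= inord_val.
have jK' : (N - j < K)%N by have := leq_ord_max j => /=; lia.
apply/imsetP; exists (Ordinal jK') => //=.
by rewrite subKn ?inord_val// (leq_ord_max j).
Qed.

Definition config_code l := (path_code K l.1, path_code K l.2).

Lemma separate_code_inj l m : TL l -> TL m ->
  K%:Z <= ups l.1 ord_max -> K%:Z <= ups m.1 ord_max ->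
  config_code l = config_code m -> separate K l = separate K m -> l = m.
Proof.
case: l m => [l1 l2] [m1 m2] [/= l0 _ sl1 sl2] [/= m0 _ sm1 sm2] /= Ul Um.
move=> [c1u c1f c2u c2f] [e1 e2]; congr pair.
  apply: (@raise_code_inj _ K) => //; first by rewrite l0.
  by rewrite /path_code c1u c1f.
by apply: (@lower_code_inj _ K) => //; rewrite /path_code c2u c2f.
Qed.

Lemma height_separate (R : realType) l (x : R) (k := Num.truncn (N%:R * x)) :
  (k < N)%N -> TL l ->
  K%:Z <= ups l.1 (inord k) -> K%:Z <= flats l.1 (inord k.+1) ->
  height (separate K l) x = height l x.
Proof.
move=> kN [_ _ s1 _] U F.
have kv : inord k = k :> nat := inordK (leqW kN).
have k1v : inord k.+1 = k.+1 :> nat := inordK (kN : (k.+1 < N.+1)%N).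
have kk1 : ((inord k : 'I_N.+1) <= (inord k.+1 : 'I_N.+1))%N by rewrite kv k1v.
rewrite /height -/k !raiseE//.
- exact: le_trans U (ups_mono s1 kk1).
- exact: le_trans F (flats_anti s1 kk1).
Qed.

End separate.

Theorem proposition2p9 (R : realType) (a b : R)
  (ha : 0 <= a) (hb : 0 <= b) (hab : a * b < 1)
  (d : nat) (hd : (0 < d)%N) (theta u v : 'I_d.+1 -> R)
  (htheta0 : 0 < theta ord0)
  (htheta : forall i j : 'I_d.+1, (i < j)%N -> theta i < theta j)
  (htheta1 : theta ord_max = 1)
  (huv : forall j : 'I_d.+1, 0 < u j < v j)
  (hslope : forall j : 'I_d.+1, (j < d)%N ->
     v ord_max - u j < theta ord_max - theta j)
  (r : nat) (hr : (0 < r)%N) (eps : R) (heps : 0 < eps) :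
  exists N0 : nat, (0 < N0)%N /\
    forall N : nat, (N0 <= N)%N ->
      (0 < Prob a b (@pinned N R d theta u v))%E ->
      ((expR (- (N%:R `^ (4 / 5))))%:E <=
         condProb a b (@few_contacts N R r eps) (@pinned N R d theta u v))%E.
Proof.
pose K := r.+1.
have [N1 poly] := poly_le_exp R (4 * K).
have [N2 Neps] := archimedean_family (2 * K)%:R (fun _ : unit => heps).
have u0 j : 0 < u j by case/andP: (huv j).
have [N3 Nu] := archimedean_family K.+1%:R u0.
(* At the last pinned point only the endpoint matters, hence the dummy value. *)
pose gap (j : 'I_d.+1) :=
  if (j < d)%N then 1 - theta j - (v ord_max - u j) else 1.
have gap0 j : 0 < gap j.
  by rewrite /gap; case: ifP => // /hslope; rewrite htheta1; lra.
have [N4 Ngap] := archimedean_family K.+1%:R gap0.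
exists (maxn 1 (maxn N1 (maxn N2 (maxn N3 N4)))); split; first by lia.
move=> N hN P0.
have N0 : (0 < N)%N by lia.
have {}poly := poly N ltac:(lia); have {}Neps := Neps N ltac:(lia) tt.
have {}Nu := Nu N ltac:(lia); have {}Ngap := Ngap N ltac:(lia).
have th (j : 'I_d.+1) : (j < d)%N -> 0 <= theta j < 1.
  move=> jd; rewrite -htheta1 htheta// andbT; case: (posnP j) => [j0|j0].
    have -> : j = ord0 by exact/val_inj.
    exact: ltW.
  by apply/ltW/(lt_trans htheta0)/htheta.
have room (l : config N) : TL l -> pinned theta u v l ->
    forall j : 'I_d.+1, (j < d)%N ->
    K%:Z <= ups l.1 (inord (Num.truncn (N%:R * theta j))) /\
    K%:Z <= flats l.1 (inord (Num.truncn (N%:R * theta j)).+1).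
  move=> Tl pl j jd; have /andP[uj _] := pl j.
  have := pl ord_max; rewrite htheta1 => /andP[_ v1].
  have := Ngap j; rewrite /gap jd.
  exact: (pinned_room N0 (th j jd) Tl uj v1 (Nu j)).
have ends (l : config N) : TL l -> pinned theta u v l ->
    K%:Z <= ups l.1 ord_max /\ K%:Z <= flats l.1 ord0.
  move=> Tl pl; have [U F] := room l Tl pl ord0 hd; have [_ _ s1 _] := Tl.
  split; first exact: le_trans U (ups_mono s1 (leq_ord_max _)).
  exact: le_trans F (@flats_anti _ l.1 ord0 _ s1 (leq0n _)).
have pin (l : config N) : TL l -> pinned theta u v l ->
    pinned theta u v (separate K l).
  move=> Tl pl j; have /= plj := pl j; have [U F] := ends l Tl pl.
  have [jd|] := ltnP j d.
    have [Uj Fj] := room l Tl pl j jd; have /andP[_ t1] := th j jd.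
    by rewrite height_separate//; apply: cell_bound.
  move=> dj; have jm : j = ord_max.
    by apply/val_inj/eqP; rewrite eqn_leq dj leq_ord_max.
  move: plj; rewrite jm htheta1.
  have Nr : N%:R != 0 :> R by rewrite pnatr_eq0 -lt0n.
  suff -> : height (separate K l) 1 = height l (1 : R) by [].
  by apply: (mulfI Nr); rewrite !height1//= raise_max.
apply: (@le_trans _ _ (((N.+2 ^ (4 * K))%:R : R)^-1)%:E).
  by rewrite lee_fin expRN lef_pV2// posrE ?expR_gt0// ltr0n expn_gt0.
apply: condProb_ge => //.
have -> : (N.+2 ^ (4 * K))%N = #|{: code_type N K * code_type N K}|.
  by rewrite card_prod card_code_type -expnD; congr expn; lia.
apply: (@esum_le_card_code _ _ _ _ _ _ (@separate N K) (@config_code N K)).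
- by move=> l; apply: mass_ge0.
- move=> l [Tl pl]; have [U F] := ends l Tl pl.
  split; first exact: separate_TL.
  split; last exact: pin.
  rewrite /few_contacts /=.
  apply: (@le_trans _ _ (2 * K)%:Z).
    rewrite lez_nat; apply: leq_trans (separate_few K Tl).
    by apply/subset_leq_card/fintype.subsetP => j; rewrite !inE /= /K; lia.
  by rewrite -(ler_int R) (le_trans _ (ceil_ge _)).
- by move=> l [Tl pl]; have [U F] := ends l Tl pl; apply: mass_separate.
- move=> l m [Tl pl] [Tm pm]; have [Ul _] := ends l Tl pl.
  have [Um _] := ends m Tm pm.
  exact: separate_code_inj.
Qed.
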